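(* The pair $\left(\left[\bigoplus_{i=2}^\infty \ell_i^2\right]_{\ell_2},\,\ell_\infty\right)$ does not satisfy property $\mathbf{L}_{p,o}$.
   Context: Banach spaces are over $\mathbb{K}$, which is $\mathbb{R}$ or $\mathbb{C}$. For an integer $i\geq 2$, $\ell_i^2$ denotes $\mathbb{K}^2$ with the $i$-norm $\|(a,b)\|_i=(|a|^i+|b|^i)^{1/i}$, and $\left[\bigoplus_{i=2}^\infty \ell_i^2\right]_{\ell_2}$ is the $\ell_2$-direct sum of these spaces, i.e. the space of sequences $(x_i)_{i\geq2}$ with $x_i\in\ell_i^2$ and norm $\left(\sum_{i\geq 2}\|x_i\|_i^2\right)^{1/2}<\infty$. $\ell_\infty$ is the space of bounded scalar sequences with the supremum norm. $S_X$ denotes the unit sphere of $X$, and $\mathcal{L}(X,Y)$ the space of bounded linear operators from $X$ to $Y$ with the operator norm. A pair $(X,Y)$ of Banach spaces has property $\mathbf{L}_{p,o}$ if for every $\varepsilon>0$ and every $T\in\mathcal{L}(X,Y)$ with $\|T\|=1$ there is $\eta(\varepsilon,T)>0$ such that whenever $x\in S_X$ satisfies $\|T(x)\|>1-\eta(\varepsilon,T)$, there is $S\in\mathcal{L}(X,Y)$ with $\|S\|=1$, $\|S(x)\|=1$ and $\|S-T\|<\varepsilon$. *)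

(* Defs.v *)
From Stdlib Require Import Reals Lra Lia Psatz.
From Stdlib Require Import ProofIrrelevance FunctionalExtensionality.
From Stdlib Require Import PropExtensionality ClassicalEpsilon.
From Coquelicot Require Import Coquelicot.

Open Scope R_scope.

Record complete_norm {K : AbsRing} (E : ModuleSpace K) (N : E -> R) : Prop := {
  cn_triangle : forall x y : E, N (plus x y) <= N x + N y;
  cn_scal : forall (k : K) (x : E), N (scal k x) <= abs k * N x;
  cn_definite : forall x : E, N x = 0 -> x = zero;
  cn_complete : forall F : (E -> Prop) -> Prop, ProperFilter F ->
    (forall eps, 0 < eps -> exists x : E, F (fun y : E => N (minus y x) < eps)) ->
    exists l : E, forall eps, 0 < eps -> F (fun y : E => N (minus y l) < eps) }.

Section BanachOfNorm.

Context {K : AbsRing} (E : ModuleSpace K) (N : E -> R) (H : complete_norm E N).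

Lemma cn_zero : N zero = 0.
Proof.
pose proof (cn_scal _ _ H (zero : K) zero) as H0.
rewrite abs_zero, (scal_zero_r (zero : K)) in H0.
pose proof (cn_triangle _ _ H zero zero) as H1.
rewrite plus_zero_l in H1. lra.
Qed.

Lemma cn_opp (x : E) : N (opp x) = N x.
Proof.
assert (A : forall y : E, N (opp y) <= N y).
{ intros y. pose proof (cn_scal _ _ H (opp one : K) y) as H0.
  rewrite abs_opp_one, (scal_opp_one y) in H0. lra. }
apply Rle_antisym; [apply A|].
rewrite <- (opp_opp x) at 1. apply A.
Qed.

Lemma cn_ball_center (x : E) (e : posreal) : N (minus x x) < e.
Proof.
rewrite (minus_eq_zero x : minus x x = (zero : E)), cn_zero. apply cond_pos.
Qed.

Lemma cn_ball_sym (x y : E) (e : R) : N (minus y x) < e -> N (minus x y) < e.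
Proof. now rewrite <- (opp_minus y x), cn_opp. Qed.

Lemma cn_ball_triangle (x y z : E) (e1 e2 : R) :
  N (minus y x) < e1 -> N (minus z y) < e2 -> N (minus z x) < e1 + e2.
Proof.
intros H1 H2. rewrite (minus_trans y).
eapply Rle_lt_trans; [apply (cn_triangle _ _ H)|lra].
Qed.

Definition cn_Uniform_mixin : UniformSpace.mixin_of E :=
  UniformSpace.Mixin E zero (fun x e y => N (minus y x) < e)
    cn_ball_center cn_ball_sym cn_ball_triangle.

Definition cn_Uniform : UniformSpace := UniformSpace.Pack E cn_Uniform_mixin E.

Definition cn_Aux_class : NormedModuleAux.class_of K E :=
  NormedModuleAux.Class K E (ModuleSpace.class K E) cn_Uniform_mixin.

Definition cn_Aux : NormedModuleAux K := NormedModuleAux.Pack K E cn_Aux_class E.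

Lemma cn_compat1 (x y : cn_Aux) (e : R) : N (minus y x) < e -> ball x e y.
Proof. intros h; exact h. Qed.

Lemma cn_compat2 (x y : cn_Aux) (e : posreal) : ball x e y -> N (minus y x) < 1 * e.
Proof. rewrite Rmult_1_l. intros h; exact h. Qed.

Definition cn_Normed_class : NormedModule.class_of K E :=
  NormedModule.Class K E cn_Aux_class
    (NormedModule.Mixin K cn_Aux N 1 (cn_triangle _ _ H) (cn_scal _ _ H)
       cn_compat1 cn_compat2 (cn_definite _ _ H)).

Definition cn_lim (F : (E -> Prop) -> Prop) : E :=
  epsilon (inhabits zero)
    (fun l => forall eps, 0 < eps -> F (fun y => N (minus y l) < eps)).

Lemma cn_lim_correct (F : (cn_Uniform -> Prop) -> Prop) :
  ProperFilter F -> cauchy F ->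
  forall eps : posreal, F (ball (cn_lim F : cn_Uniform) eps).
Proof.
intros HF Hc eps.
apply (epsilon_spec (inhabits zero)
  (fun l => forall eps, 0 < eps -> F (fun y => N (minus y l) < eps))).
- apply (cn_complete _ _ H F HF).
  intros e He. exact (Hc (mkposreal e He)).
- apply cond_pos.
Qed.

Lemma cn_lim_close (F G : (cn_Uniform -> Prop) -> Prop) :
  filter_le F G -> filter_le G F ->
  close (cn_lim F : cn_Uniform) (cn_lim G : cn_Uniform).
Proof.
intros FG GF.
replace G with F; [apply close_refl|].
apply functional_extensionality; intros A.
apply propositional_extensionality; split; [apply GF | apply FG].
Qed.

Definition banach_of_norm : CompleteNormedModule K :=
  CompleteNormedModule.Pack K E
    (CompleteNormedModule.Class K E cn_Normed_class
       (CompleteSpace.Mixin cn_Uniform cn_lim cn_lim_correct cn_lim_close)) E.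

End BanachOfNorm.

Section SeqModule.

Context {K : Ring} (E : nat -> ModuleSpace K).

Let T := forall n, E n.

Definition seq_Monoid_mixin : AbelianMonoid.mixin_of T.
Proof.
refine (AbelianMonoid.Mixin T (fun x y n => plus (x n) (y n)) (fun n => zero) _ _ _);
  intros; apply functional_extensionality_dep; intros n.
- apply plus_comm.
- apply plus_assoc.
- apply plus_zero_r.
Defined.

Definition seq_Group_mixin :
  AbelianGroup.mixin_of (AbelianMonoid.Pack T seq_Monoid_mixin T).
Proof.
refine (AbelianGroup.Mixin (AbelianMonoid.Pack T seq_Monoid_mixin T)
  (fun x n => opp (x n)) _).
intros x; apply functional_extensionality_dep; intros n. exact (plus_opp_r (x n)).
Defined.

Definition seq_Group_class : AbelianGroup.class_of T :=
  AbelianGroup.Class T seq_Monoid_mixin seq_Group_mixin.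

Definition seq_Module_mixin :
  ModuleSpace.mixin_of K (AbelianGroup.Pack T seq_Group_class T).
Proof.
refine (ModuleSpace.Mixin K (AbelianGroup.Pack T seq_Group_class T)
  (fun k x n => scal k (x n)) _ _ _ _);
  intros; apply functional_extensionality_dep; intros n.
- apply scal_assoc.
- exact (scal_one (u n)).
- exact (scal_distr_l x (u n) (v n)).
- exact (scal_distr_r x y (u n)).
Defined.

Definition seq_ModuleSpace : ModuleSpace K :=
  ModuleSpace.Pack K T (ModuleSpace.Class K T seq_Group_class seq_Module_mixin) T.

End SeqModule.

Record submodule {K : Ring} (E : ModuleSpace K) (P : E -> Prop) : Prop := {
  sm_zero : P zero;
  sm_plus : forall x y : E, P x -> P y -> P (plus x y);
  sm_scal : forall (k : K) (x : E), P x -> P (scal k x) }.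

Section SubModule.

Context {K : Ring} (E : ModuleSpace K) (P : E -> Prop) (H : submodule E P).

Let T := {x : E | P x}.

Lemma sm_eq (x y : T) : proj1_sig x = proj1_sig y -> x = y.
Proof. apply eq_sig_hprop. intros; apply proof_irrelevance. Qed.

Lemma sm_opp (x : E) : P x -> P (opp x).
Proof. intros h. rewrite <- scal_opp_one. now apply (sm_scal _ _ H). Qed.

Definition sub_Monoid_mixin : AbelianMonoid.mixin_of T.
Proof.
refine (AbelianMonoid.Mixin T
  (fun x y => exist P (plus (proj1_sig x) (proj1_sig y))
                (sm_plus _ _ H _ _ (proj2_sig x) (proj2_sig y)))
  (exist P zero (sm_zero _ _ H)) _ _ _);
  intros; apply sm_eq; simpl.
- apply plus_comm.
- apply plus_assoc.
- apply plus_zero_r.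
Defined.

Definition sub_Group_mixin :
  AbelianGroup.mixin_of (AbelianMonoid.Pack T sub_Monoid_mixin T).
Proof.
refine (AbelianGroup.Mixin (AbelianMonoid.Pack T sub_Monoid_mixin T)
  (fun x => exist P (opp (proj1_sig x)) (sm_opp _ (proj2_sig x))) _).
intros x; apply sm_eq; exact (plus_opp_r (proj1_sig x)).
Defined.

Definition sub_Group_class : AbelianGroup.class_of T :=
  AbelianGroup.Class T sub_Monoid_mixin sub_Group_mixin.

Definition sub_Module_mixin :
  ModuleSpace.mixin_of K (AbelianGroup.Pack T sub_Group_class T).
Proof.
refine (ModuleSpace.Mixin K (AbelianGroup.Pack T sub_Group_class T)
  (fun k x => exist P (scal k (proj1_sig x)) (sm_scal _ _ H k _ (proj2_sig x)))
  _ _ _ _); intros; apply sm_eq; simpl.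
- apply scal_assoc.
- apply scal_one.
- apply scal_distr_l.
- apply scal_distr_r.
Defined.

Definition sub_ModuleSpace : ModuleSpace K :=
  ModuleSpace.Pack K T (ModuleSpace.Class K T sub_Group_class sub_Module_mixin) T.

End SubModule.

Lemma norm_minus_sym {K : AbsRing} {V : NormedModule K} (x y : V) :
  norm (minus x y) = norm (minus y x).
Proof. now rewrite <- (opp_minus y x), norm_opp. Qed.

Lemma filter_norm_lim {K : AbsRing} {V : CompleteNormedModule K} {T : Type}
  (F : (T -> Prop) -> Prop) (f : T -> V) :
  ProperFilter F ->
  (forall eps, 0 < eps -> exists x : V, F (fun y => norm (minus (f y) x) < eps)) ->
  exists l : V, forall eps, 0 < eps -> F (fun y => norm (minus (f y) l) < eps).
Proof.
intros HF Hc.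
assert (Hc' : cauchy (filtermap f F)).
{ intros eps. destruct (Hc eps (cond_pos eps)) as [x Hx].
  exists x. unfold filtermap. revert Hx. apply filter_imp.
  intros y Hy. exact (norm_compat1 x (f y) eps Hy). }
exists (lim (filtermap f F)). intros eps Heps.
pose proof (@norm_factor_gt_0 K V) as Hf.
assert (He : 0 < eps / @norm_factor K V) by (apply Rdiv_lt_0_compat; lra).
pose proof (complete_cauchy (filtermap f F) (filtermap_proper_filter _ _ f F HF) Hc'
  (mkposreal _ He)) as HL.
unfold filtermap in HL at 1. revert HL. apply filter_imp. intros y Hy.
pose proof (norm_compat2 _ _ _ Hy) as Hy'. simpl in Hy'.
eapply Rlt_le_trans; [exact Hy'|]. apply Req_le. field. lra.
Qed.

Record sup_seminorms (q : nat -> (nat -> R) -> R) : Prop := {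
  ss_mono : forall m a b, (forall n, 0 <= a n <= b n) -> q m a <= q m b;
  ss_plus : forall m a b, (forall n, 0 <= a n) -> (forall n, 0 <= b n) ->
    q m (fun n => a n + b n) <= q m a + q m b;
  ss_scal : forall m c a, 0 <= c -> (forall n, 0 <= a n) ->
    q m (fun n => c * a n) <= c * q m a;
  ss_ge : forall n a, (forall n, 0 <= a n) -> a n <= q n a;
  ss_small : forall m d, 0 < d -> exists e, 0 < e /\
    forall a, (forall n, 0 <= a n) -> (forall n, (n <= m)%nat -> a n < e) -> q m a < d }.

Section SeqNorm.

Context {K : AbsRing} (E : nat -> CompleteNormedModule K).
Context (q : nat -> (nat -> R) -> R) (Hq : sup_seminorms q).

Let X : ModuleSpace K := seq_ModuleSpace (fun n => E n).
Let nu (x : X) : nat -> R := fun n => norm (x n).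

Context (P : X -> Prop) (HP : forall x, P x <-> exists M, forall m, q m (nu x) <= M).

Lemma nu_ge0 x n : 0 <= nu x n.
Proof. apply norm_ge_0. Qed.

Lemma q_nu_plus m (x y : X) : q m (nu (plus x y)) <= q m (nu x) + q m (nu y).
Proof.
eapply Rle_trans; [|apply (ss_plus _ Hq); apply nu_ge0].
apply (ss_mono _ Hq). intros n; split; [apply nu_ge0 | exact (norm_triangle (x n) (y n))].
Qed.

Lemma q_nu_scal m (k : K) (x : X) : q m (nu (scal k x)) <= abs k * q m (nu x).
Proof.
eapply Rle_trans; [|apply (ss_scal _ Hq); [apply abs_ge_0 | apply nu_ge0]].
apply (ss_mono _ Hq). intros n; split; [apply nu_ge0 | exact (norm_scal k (x n))].
Qed.

Lemma q_nu_zero m : q m (nu zero) <= 0.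
Proof.
pose proof (q_nu_scal m (zero : K) zero) as H0.
rewrite abs_zero, (scal_zero_r (zero : K)) in H0. lra.
Qed.

Lemma q_submodule : submodule X P.
Proof.
split.
- apply HP. exists 0. exact q_nu_zero.
- intros x y Hx Hy. apply HP in Hx as [M HM]. apply HP in Hy as [M' HM'].
  apply HP. exists (M + M'). intros m. eapply Rle_trans; [apply q_nu_plus|].
  specialize (HM m); specialize (HM' m); lra.
- intros k x Hx. apply HP in Hx as [M HM].
  apply HP. exists (abs k * M). intros m. eapply Rle_trans; [apply q_nu_scal|].
  apply Rmult_le_compat_l; [apply abs_ge_0 | apply HM].
Qed.

Let Y := sub_ModuleSpace X P q_submodule.

Context (N : Y -> R)
  (HN : forall x : Y, is_lub_Rbar (fun r => exists m, r = q m (nu (proj1_sig x))) (N x)).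

Lemma N_ub (x : Y) m : q m (nu (proj1_sig x)) <= N x.
Proof. apply (proj1 (HN x)). now exists m. Qed.

Lemma N_least (x : Y) M : (forall m, q m (nu (proj1_sig x)) <= M) -> N x <= M.
Proof.
intros h. apply (proj2 (HN x) (Finite M)). intros r [m ->]. apply h.
Qed.

Lemma N_coord (x : Y) n : norm (proj1_sig x n) <= N x.
Proof.
eapply Rle_trans; [|apply (N_ub x n)].
apply (ss_ge _ Hq n (nu (proj1_sig x))), nu_ge0.
Qed.

Lemma seq_complete_norm : complete_norm Y N.
Proof.
split.
- intros x y. apply N_least. intros m.
  eapply Rle_trans; [apply (q_nu_plus m (proj1_sig x) (proj1_sig y))|].
  apply Rplus_le_compat; apply N_ub.
- intros k x. apply N_least. intros m.
  eapply Rle_trans; [apply (q_nu_scal m k (proj1_sig x))|].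
  apply Rmult_le_compat_l; [apply abs_ge_0 | apply N_ub].
- intros x Hx. apply sm_eq. apply functional_extensionality_dep. intros n.
  apply (norm_eq_zero (proj1_sig x n)).
  apply Rle_antisym; [rewrite <- Hx; apply N_coord | apply norm_ge_0].
- intros F HF Hc.
  assert (Hl : forall n, exists l : E n, forall eps, 0 < eps ->
    F (fun y : Y => norm (minus (proj1_sig y n) l) < eps)).
  { intros n. apply (filter_norm_lim F (fun y : Y => proj1_sig y n) HF).
    intros eps Heps. destruct (Hc eps Heps) as [x Hx].
    exists (proj1_sig x n). revert Hx. apply filter_imp. intros y Hy.
    eapply Rle_lt_trans; [|exact Hy]. exact (N_coord (minus y x) n). }
  pose (l := (fun n => proj1_sig (constructive_indefinite_description _ (Hl n))) : X).
  assert (Hl' : forall n eps, 0 < eps ->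
    F (fun y : Y => norm (minus (proj1_sig y n) (l n)) < eps)).
  { intros n. exact (proj2_sig (constructive_indefinite_description _ (Hl n))). }
  clearbody l.
  assert (Hfin : forall m eps, 0 < eps ->
    F (fun y : Y => forall n, (n <= m)%nat -> norm (minus (proj1_sig y n) (l n)) < eps)).
  { intros m eps Heps. induction m as [|m IH].
    - generalize (Hl' 0%nat eps Heps). apply filter_imp. intros y Hy n Hn.
      now replace n with 0%nat by lia.
    - generalize (filter_and _ _ IH (Hl' (S m) eps Heps)). apply filter_imp.
      intros y [Hy Hy'] n Hn. destruct (PeanoNat.Nat.eq_dec n (S m)) as [->|Hne]; auto.
      apply Hy. lia. }
  assert (Hkey : forall eps (x : Y), F (fun y => N (minus y x) < eps) ->
    forall m, q m (nu (minus l (proj1_sig x))) <= eps).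
  { intros eps x Hx m. apply le_epsilon. intros d Hd.
    destruct (ss_small _ Hq m d Hd) as [e [He Hs]].
    destruct (filter_ex _ (filter_and _ _ Hx (Hfin m e He))) as [y [Hy Hy']].
    replace (minus l (proj1_sig x))
      with (plus (minus (proj1_sig y) (proj1_sig x)) (minus l (proj1_sig y))).
    2: { rewrite plus_comm. symmetry. apply minus_trans. }
    eapply Rle_trans; [apply q_nu_plus|].
    apply Rplus_le_compat.
    - left. eapply Rle_lt_trans; [|exact Hy]. exact (N_ub (minus y x) m).
    - left. apply Hs; [apply nu_ge0|]. intros n Hn.
      eapply Rle_lt_trans; [|exact (Hy' n Hn)].
      apply Req_le. exact (norm_minus_sym (l n) (proj1_sig y n)). }
  assert (Pl : P l).
  { destruct (Hc 1 Rlt_0_1) as [x Hx].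
    apply HP. exists (1 + N x). intros m.
    replace l with (plus (minus l (proj1_sig x)) (proj1_sig x)).
    2: { unfold minus. rewrite <- plus_assoc, plus_opp_l. apply plus_zero_r. }
    eapply Rle_trans; [apply q_nu_plus|].
    apply Rplus_le_compat; [now apply Hkey | apply N_ub]. }
  exists (exist P l Pl). intros eps Heps.
  destruct (Hc (eps / 3)) as [x Hx]; [lra|].
  generalize Hx. apply filter_imp. intros y Hy.
  apply Rle_lt_trans with (eps / 3 + eps / 3); [|lra].
  apply N_least. intros m.
  change (q m (nu (minus (proj1_sig y) l)) <= eps / 3 + eps / 3).
  rewrite (minus_trans (proj1_sig x)).
  eapply Rle_trans; [apply q_nu_plus|]. apply Rplus_le_compat.
  + left. eapply Rle_lt_trans; [|exact Hy]. exact (N_ub (minus y x) m).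
  + eapply Rle_trans; [|apply (Hkey (eps / 3) x Hx m)].
    apply (ss_mono _ Hq). intros n; split; [apply nu_ge0|].
    apply Req_le. exact (norm_minus_sym (proj1_sig x n) (l n)).
Qed.

End SeqNorm.

Section Linf.

Context {K : AbsRing} (V : CompleteNormedModule K).

Definition bounded_seq (x : seq_ModuleSpace (fun _ : nat => (V : ModuleSpace K))) : Prop :=
  exists M, forall n, norm (x n) <= M.

Lemma linf_seminorms : sup_seminorms (fun m a => a m).
Proof.
split; intros; try lra.
- apply H.
- exists d. split; [assumption|]. intros a _ h. now apply h.
Qed.

Definition bounded_seq_submodule : submodule _ bounded_seq :=
  q_submodule (fun _ => V) _ linf_seminorms bounded_seq (fun _ => conj (fun h => h) (fun h => h)).

Definition linf_ModuleSpace : ModuleSpace K := sub_ModuleSpace _ _ bounded_seq_submodule.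

Definition linf_norm (x : linf_ModuleSpace) : R :=
  real (Lub_Rbar (fun r => exists n, r = norm (proj1_sig x n))).

Lemma linf_complete_norm : complete_norm linf_ModuleSpace linf_norm.
Proof.
apply (seq_complete_norm (fun _ => V) (fun m a => a m)).
intros [x [M HM]]. unfold linf_norm. simpl.
set (A := fun r => exists n, r = norm (x n)).
pose proof (Lub_Rbar_correct A) as HL.
destruct (Lub_Rbar A) as [r| |]; [exact HL| |]; exfalso.
- destruct HL as [_ HL]. apply (HL (Finite M)). intros r [n ->]. apply HM.
- destruct HL as [HL _]. apply (HL (norm (x 0%nat))). now exists 0%nat.
Qed.

Definition linf : CompleteNormedModule K := banach_of_norm _ _ linf_complete_norm.

End Linf.

Lemma sqrt_minkowski a b c d : 0 <= a -> 0 <= b -> 0 <= c -> 0 <= d ->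
  sqrt ((a + c) ^ 2 + (b + d) ^ 2) <= sqrt (a ^ 2 + b ^ 2) + sqrt (c ^ 2 + d ^ 2).
Proof.
intros Ha Hb Hc Hd.
pose proof (sqrt_pos (a ^ 2 + b ^ 2)). pose proof (sqrt_pos (c ^ 2 + d ^ 2)).
assert (Hcs : a * c + b * d <= sqrt (a ^ 2 + b ^ 2) * sqrt (c ^ 2 + d ^ 2)).
{ rewrite <- sqrt_mult by nra. rewrite <- (sqrt_pow2 (a * c + b * d)) by nra.
  apply sqrt_le_1_alt. pose proof (pow2_ge_0 (a * d - b * c)). nra. }
rewrite <- (sqrt_pow2 (sqrt (a ^ 2 + b ^ 2) + sqrt (c ^ 2 + d ^ 2))) by lra.
apply sqrt_le_1_alt.
pose proof (pow2_sqrt (a ^ 2 + b ^ 2)). pose proof (pow2_sqrt (c ^ 2 + d ^ 2)). nra.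
Qed.

Definition l2_partial (m : nat) (a : nat -> R) : R := sqrt (sum_f_R0 (fun n => a n ^ 2) m).

Lemma sum_sq_ge0 (a : nat -> R) m : 0 <= sum_f_R0 (fun n => a n ^ 2) m.
Proof. apply cond_pos_sum. intros; apply pow2_ge_0. Qed.

Lemma l2_partial_S m a :
  l2_partial (S m) a = sqrt (l2_partial m a ^ 2 + a (S m) ^ 2).
Proof. unfold l2_partial. rewrite pow2_sqrt by apply sum_sq_ge0. reflexivity. Qed.

Lemma l2_partial_0 a : 0 <= a 0%nat -> l2_partial 0 a = a 0%nat.
Proof. exact (sqrt_pow2 (a 0%nat)). Qed.

Lemma l2_seminorms : sup_seminorms l2_partial.
Proof.
split.
- intros m a b h. apply sqrt_le_1_alt. apply sum_Rle. intros n _.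
  apply pow_incr, h.
- intros m a b ha hb. induction m as [|m IH].
  + rewrite !l2_partial_0; auto; try lra.
    apply Rplus_le_le_0_compat; auto.
  + rewrite !l2_partial_S.
    eapply Rle_trans; [|apply sqrt_minkowski; auto; apply sqrt_pos].
    apply sqrt_le_1_alt. apply Rplus_le_compat_r. apply pow_incr.
    split; [apply sqrt_pos | exact IH].
- intros m c a hc ha. unfold l2_partial.
  replace (c * sqrt (sum_f_R0 (fun n => a n ^ 2) m))
    with (sqrt (c ^ 2) * sqrt (sum_f_R0 (fun n => a n ^ 2) m))
    by now rewrite (sqrt_pow2 c hc).
  rewrite <- sqrt_mult by (try apply pow2_ge_0; apply sum_sq_ge0).
  apply sqrt_le_1_alt. rewrite scal_sum. apply Req_le.
  apply sum_eq. intros; ring.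
- intros n a ha. rewrite <- (sqrt_pow2 (a n)) at 1 by auto.
  apply sqrt_le_1_alt. destruct n as [|n]; [apply Rle_refl|]. rewrite tech5.
  pose proof (sum_sq_ge0 a n). lra.
- intros m d Hd.
  assert (Hm : 0 < INR (S m)) by (apply lt_0_INR; lia).
  assert (Hs : 0 < sqrt (INR (S m))) by now apply sqrt_lt_R0.
  exists (d / (2 * sqrt (INR (S m)))). split; [apply Rdiv_lt_0_compat; lra|].
  intros a ha h. apply Rle_lt_trans with (d / 2); [|lra].
  unfold l2_partial. rewrite <- (sqrt_pow2 (d / 2)) by lra.
  apply sqrt_le_1_alt.
  apply Rle_trans with (sum_f_R0 (fun _ => (d / (2 * sqrt (INR (S m)))) ^ 2) m).
  + apply sum_Rle. intros n Hn. apply pow_incr. split; [auto | left; auto].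
  + rewrite sum_cte. apply Req_le.
    pose proof (pow2_sqrt (INR (S m)) (Rlt_le _ _ Hm)) as E.
    rewrite <- E at 2. field. lra.
Qed.

Section L2Sum.

Context {K : AbsRing} (E : nat -> CompleteNormedModule K).

Definition square_summable (x : seq_ModuleSpace (fun n => (E n : ModuleSpace K))) : Prop :=
  ex_series (fun n => norm (x n) ^ 2).

Lemma sq_series_lub (a : nat -> R) M : (forall m, l2_partial m a <= M) ->
  ex_series (fun n => a n ^ 2).
Proof.
intros h.
apply (ex_finite_lim_seq_incr (sum_n (fun n => a n ^ 2)) (M ^ 2)).
- intros n. rewrite sum_Sn. unfold plus; simpl.
  pose proof (pow2_ge_0 (a (S n))). simpl in *. lra.
- intros n. rewrite sum_n_Reals, <- (pow2_sqrt (sum_f_R0 _ n)) by apply sum_sq_ge0.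
  apply pow_incr. split; [apply sqrt_pos | apply h].
Qed.

Lemma sum_sq_le_Series (a : nat -> R) m : ex_series (fun n => a n ^ 2) ->
  sum_f_R0 (fun n => a n ^ 2) m <= Series (fun n => a n ^ 2).
Proof.
intros h. rewrite <- sum_n_Reals.
apply (is_lim_seq_incr_compare (sum_n (fun n => a n ^ 2))).
- apply (Series_correct _ h).
- intros n. rewrite sum_Sn. unfold plus; simpl.
  pose proof (pow2_ge_0 (a (S n))). simpl in *. lra.
Qed.

Lemma square_summableP x :
  square_summable x <-> exists M, forall m, l2_partial m (fun n => norm (x n)) <= M.
Proof.
split.
- intros h. exists (sqrt (Series (fun n => norm (x n) ^ 2))). intros m.
  apply sqrt_le_1_alt. now apply (sum_sq_le_Series (fun n => norm (x n))).
- intros [M HM]. exact (sq_series_lub _ M HM).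
Qed.

Definition square_summable_submodule : submodule _ square_summable :=
  q_submodule E _ l2_seminorms square_summable square_summableP.

Definition l2_sum_ModuleSpace : ModuleSpace K :=
  sub_ModuleSpace _ _ square_summable_submodule.

Definition l2_sum_norm (x : l2_sum_ModuleSpace) : R :=
  sqrt (Series (fun n => norm (proj1_sig x n) ^ 2)).

Lemma l2_sum_complete_norm : complete_norm l2_sum_ModuleSpace l2_sum_norm.
Proof.
apply (seq_complete_norm E l2_partial).
intros [x Hx]. unfold l2_sum_norm; simpl proj1_sig. split.
- intros r [m ->]. apply sqrt_le_1_alt.
  now apply (sum_sq_le_Series (fun n => norm (x n))).
- intros [b| |] Hb.
  + assert (Hm : forall m, l2_partial m (fun n => norm (x n)) <= b).
    { intros m. apply (Hb (l2_partial m (fun n => norm (x n)))). now exists m. }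
    assert (0 <= b) by (eapply Rle_trans; [apply sqrt_pos | apply (Hm 0%nat)]).
    simpl. rewrite <- (sqrt_pow2 b) by assumption. apply sqrt_le_1_alt.
    apply (is_lim_seq_le (sum_n (fun n => norm (x n) ^ 2)) (fun _ => b ^ 2)
      (Series (fun n => norm (x n) ^ 2)) (b ^ 2)).
    * intros m. rewrite sum_n_Reals.
      rewrite <- (pow2_sqrt (sum_f_R0 _ m)) by apply sum_sq_ge0.
      apply pow_incr. split; [apply sqrt_pos | apply Hm].
    * apply (Series_correct _ Hx).
    * apply is_lim_seq_const.
  + exact I.
  + apply (Hb (l2_partial 0 (fun n => norm (x n)))). now exists 0%nat.
Qed.

Definition l2_sum : CompleteNormedModule K := banach_of_norm _ _ l2_sum_complete_norm.

End L2Sum.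

(* [Rpower 0 y = 1] in the standard library, so zero is treated apart. *)
Definition nth_root (p : nat) (x : R) : R :=
  if Rle_dec x 0 then 0 else Rpower x (/ INR p).

Lemma nth_root_ge0 p x : 0 <= nth_root p x.
Proof.
unfold nth_root. destruct (Rle_dec x 0); [lra|]. left. apply exp_pos.
Qed.

Lemma nth_root_pow p x : (1 <= p)%nat -> 0 <= x -> nth_root p x ^ p = x.
Proof.
intros Hp Hx. unfold nth_root. destruct (Rle_dec x 0) as [h|h].
- rewrite pow_i by lia. lra.
- rewrite <- Rpower_pow by apply exp_pos.
  rewrite Rpower_mult, Rinv_l by (apply not_0_INR; lia).
  apply Rpower_1. lra.
Qed.

Lemma pow_le_inv p x y : (1 <= p)%nat -> 0 <= x -> 0 <= y -> x ^ p <= y ^ p -> x <= y.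
Proof.
intros Hp Hx Hy h. destruct (Rle_lt_dec x y) as [|Hlt]; [assumption|exfalso].
assert (y ^ p < x ^ p); [|lra].
destruct p as [|p]; [lia|]. clear h.
assert (Hi : y ^ p <= x ^ p) by (apply pow_incr; lra).
simpl. apply Rle_lt_trans with (y * x ^ p).
- now apply Rmult_le_compat_l.
- apply Rmult_lt_compat_r; [apply pow_lt; lra | assumption].
Qed.

Lemma nth_root_le p x y : (1 <= p)%nat -> 0 <= x -> 0 <= y -> x <= y ^ p -> nth_root p x <= y.
Proof.
intros Hp Hx Hy h. apply (pow_le_inv p); auto; [apply nth_root_ge0|].
now rewrite nth_root_pow.
Qed.

Lemma pow_convex n t s u v : 0 <= t -> 0 <= s -> t + s = 1 -> 0 <= u -> 0 <= v ->
  (t * u + s * v) ^ n <= t * u ^ n + s * v ^ n.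
Proof.
intros Ht Hs Hts Hu Hv. induction n as [|n IH]; [simpl; lra|].
simpl. apply Rle_trans with ((t * u + s * v) * (t * u ^ n + s * v ^ n)).
- apply Rmult_le_compat_l; [nra | exact IH].
- assert (Hm : 0 <= (u - v) * (u ^ n - v ^ n)).
  { destruct (Rle_lt_dec u v).
    - assert (u ^ n <= v ^ n) by (apply pow_incr; lra). nra.
    - assert (v ^ n <= u ^ n) by (apply pow_incr; lra). nra. }
  pose proof (Rmult_le_pos _ _ (Rmult_le_pos _ _ Ht Hs) Hm) as Hts'.
  replace s with (1 - t) in Hts' |- * by lra.
  apply Rminus_le.
  replace (_ - _) with (- (t * (1 - t) * ((u - v) * (u ^ n - v ^ n)))) by ring. lra.
Qed.

Lemma nth_root_minkowski p a b c d : (1 <= p)%nat ->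
  0 <= a -> 0 <= b -> 0 <= c -> 0 <= d ->
  nth_root p ((a + c) ^ p + (b + d) ^ p) <=
  nth_root p (a ^ p + b ^ p) + nth_root p (c ^ p + d ^ p).
Proof.
intros Hp Ha Hb Hc Hd.
assert (Hpos : forall x y, 0 <= x -> 0 <= y -> 0 <= x ^ p + y ^ p).
{ intros; apply Rplus_le_le_0_compat; now apply pow_le. }
assert (Hzero : forall x y, 0 <= x -> 0 <= y -> x ^ p + y ^ p = 0 -> x = 0 /\ y = 0).
{ intros x y Hx Hy h. pose proof (pow_le x p Hx). pose proof (pow_le y p Hy).
  assert (x ^ p = 0) by lra. assert (y ^ p = 0) by lra.
  destruct (Req_dec x 0); [|exfalso; now apply (pow_nonzero x p)].
  destruct (Req_dec y 0); [|exfalso; now apply (pow_nonzero y p)]. now split. }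
pose proof (nth_root_pow p _ Hp (Hpos a b Ha Hb)) as EA.
pose proof (nth_root_pow p _ Hp (Hpos c d Hc Hd)) as EB.
pose proof (nth_root_ge0 p (a ^ p + b ^ p)) as GA.
pose proof (nth_root_ge0 p (c ^ p + d ^ p)) as GB.
remember (nth_root p (a ^ p + b ^ p)) as A eqn:DA.
remember (nth_root p (c ^ p + d ^ p)) as B eqn:DB.
destruct (Req_dec A 0) as [HA|HA].
{ rewrite HA, pow_i in EA by lia. symmetry in EA.
  apply Hzero in EA as [-> ->]; auto. rewrite !Rplus_0_l, <- DB. lra. }
destruct (Req_dec B 0) as [HB|HB].
{ rewrite HB, pow_i in EB by lia. symmetry in EB.
  apply Hzero in EB as [-> ->]; auto. rewrite !Rplus_0_r, <- DA. lra. }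
apply nth_root_le; [assumption | apply Hpos; lra | lra |].
assert (Hconv : forall x y, 0 <= x -> 0 <= y ->
  (x + y) ^ p <= (A + B) ^ p * (A / (A + B) * (x ^ p / A ^ p) + B / (A + B) * (y ^ p / B ^ p))).
{ intros x y Hx Hy.
  replace (x + y) with ((A + B) * (A / (A + B) * (x / A) + B / (A + B) * (y / B)))
    by (field; lra).
  rewrite Rpow_mult_distr. apply Rmult_le_compat_l; [apply pow_le; lra|].
  replace (x ^ p / A ^ p) with ((x / A) ^ p)
    by (unfold Rdiv; rewrite Rpow_mult_distr, pow_inv; reflexivity).
  replace (y ^ p / B ^ p) with ((y / B) ^ p)
    by (unfold Rdiv; rewrite Rpow_mult_distr, pow_inv; reflexivity).
  apply pow_convex; try (apply Rdiv_le_0_compat; lra). field; lra. }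
pose proof (Hconv a c Ha Hc). pose proof (Hconv b d Hb Hd).
apply Rle_trans with ((A + B) ^ p *
  (A / (A + B) * ((a ^ p + b ^ p) / A ^ p) + B / (A + B) * ((c ^ p + d ^ p) / B ^ p))).
- unfold Rdiv in *. lra.
- rewrite <- EA, <- EB. apply Req_le. field.
  repeat split; try lra; apply pow_nonzero; lra.
Qed.

Section LpPlane.

Context (p : nat) (Hp : (1 <= p)%nat) {K : AbsRing} (V : CompleteNormedModule K).

Definition lp_plane_norm (x : prod_ModuleSpace K V V) : R :=
  nth_root p (norm (fst x) ^ p + norm (snd x) ^ p).

Lemma lp_sum_ge0 x y : 0 <= x -> 0 <= y -> 0 <= x ^ p + y ^ p.
Proof. intros; apply Rplus_le_le_0_compat; now apply pow_le. Qed.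

Lemma lp_plane_norm_pow x : lp_plane_norm x ^ p = norm (fst x) ^ p + norm (snd x) ^ p.
Proof. apply nth_root_pow; [assumption | apply lp_sum_ge0; apply norm_ge_0]. Qed.

Lemma lp_plane_fst x : norm (fst x) <= lp_plane_norm x.
Proof.
apply (pow_le_inv p); [assumption | apply norm_ge_0 | apply nth_root_ge0 |].
rewrite lp_plane_norm_pow, <- (Rplus_0_r (norm (fst x) ^ p)) at 1.
apply Rplus_le_compat_l, pow_le, norm_ge_0.
Qed.

Lemma lp_plane_snd x : norm (snd x) <= lp_plane_norm x.
Proof.
apply (pow_le_inv p); [assumption | apply norm_ge_0 | apply nth_root_ge0 |].
rewrite lp_plane_norm_pow, <- (Rplus_0_l (norm (snd x) ^ p)) at 1.
apply Rplus_le_compat_r, pow_le, norm_ge_0.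
Qed.

Lemma lp_plane_le x : lp_plane_norm x <= norm (fst x) + norm (snd x).
Proof.
assert (A : forall u v, 0 <= u -> 0 <= v -> u ^ p + v ^ p <= (u + v) ^ p).
{ intros u v Hu Hv. destruct p as [|k]; [lia|]. simpl.
  assert (u ^ k <= (u + v) ^ k) by (apply pow_incr; lra).
  assert (v ^ k <= (u + v) ^ k) by (apply pow_incr; lra). nra. }
apply nth_root_le; [assumption | apply lp_sum_ge0; apply norm_ge_0 | |].
- apply Rplus_le_le_0_compat; apply norm_ge_0.
- apply A; apply norm_ge_0.
Qed.

Lemma lp_plane_complete_norm : complete_norm (prod_ModuleSpace K V V) lp_plane_norm.
Proof.
split.
- intros x y. eapply Rle_trans; [|apply nth_root_minkowski; auto; apply norm_ge_0].
  apply nth_root_le; [assumption | apply lp_sum_ge0; apply norm_ge_0 | apply nth_root_ge0 |].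
  rewrite nth_root_pow; [|assumption|].
  + apply Rplus_le_compat; apply pow_incr; split; try apply norm_ge_0;
      apply (norm_triangle (V := V)).
  + apply lp_sum_ge0; apply Rplus_le_le_0_compat; apply norm_ge_0.
- intros k x. apply nth_root_le; [assumption | apply lp_sum_ge0; apply norm_ge_0 | |].
  + apply Rmult_le_pos; [apply abs_ge_0 | apply nth_root_ge0].
  + rewrite Rpow_mult_distr, lp_plane_norm_pow, Rmult_plus_distr_l, <- !Rpow_mult_distr.
    apply Rplus_le_compat; apply pow_incr; split; try apply norm_ge_0;
      apply (norm_scal (V := V)).
- intros [a b] h. pose proof (lp_plane_fst (a, b)) as H1.
  pose proof (lp_plane_snd (a, b)) as H2. rewrite h in H1, H2. simpl in H1, H2.
  apply (f_equal2 (@pair V V)); apply (norm_eq_zero (V := V)); apply Rle_antisym; auto;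
    apply norm_ge_0.
- intros F HF Hc.
  destruct (filter_norm_lim (V := V) F fst HF) as [a Ha].
  { intros eps Heps. destruct (Hc eps Heps) as [x Hx]. exists (fst x).
    revert Hx. apply filter_imp. intros y Hy.
    eapply Rle_lt_trans; [|exact Hy]. exact (lp_plane_fst (minus y x)). }
  destruct (filter_norm_lim (V := V) F snd HF) as [b Hb].
  { intros eps Heps. destruct (Hc eps Heps) as [x Hx]. exists (snd x).
    revert Hx. apply filter_imp. intros y Hy.
    eapply Rle_lt_trans; [|exact Hy]. exact (lp_plane_snd (minus y x)). }
  exists (a, b). intros eps Heps.
  assert (He : 0 < eps / 2) by lra.
  generalize (filter_and _ _ (Ha _ He) (Hb _ He)). apply filter_imp.
  intros y [H1 H2]. eapply Rle_lt_trans; [apply lp_plane_le|].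
  replace eps with (eps / 2 + eps / 2) by lra. apply Rplus_lt_compat; [exact H1 | exact H2].
Qed.

Definition lp_plane : CompleteNormedModule K := banach_of_norm _ _ lp_plane_complete_norm.

End LpPlane.

Definition op_norm {K : AbsRing} {X Y : NormedModule K} (T : X -> Y) : R :=
  real (Lub_Rbar (fun r => exists x, norm x <= 1 /\ r = norm (T x))).

(* [is_linear] is Coquelicot's predicate of bounded linear maps, so every
   [op_norm] in [property_Lpo] is the supremum of a nonempty bounded set. *)
Definition property_Lpo {K : AbsRing} (X Y : CompleteNormedModule K) : Prop :=
  forall eps : R, 0 < eps ->
  forall T : X -> Y, is_linear T -> op_norm T = 1 ->
  exists eta : R, 0 < eta /\
    forall x : X, norm x = 1 -> norm (T x) > 1 - eta ->
    exists S : X -> Y, is_linear S /\ op_norm S = 1 /\ norm (S x) = 1 /\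
      op_norm (fun z => minus (S z) (T z)) < eps.

Lemma block_exponent_ge1 (n : nat) : (1 <= n + 2)%nat.
Proof. lia. Qed.

(* Exponents start at 2 and sequences at 0: the summand with the i-norm has
   index [i - 2].  [V] is the scalar field seen as a module over itself. *)
Definition l2_sum_of_planes {K : AbsRing} (V : CompleteNormedModule K) :
  CompleteNormedModule K :=
  l2_sum (fun n => lp_plane (n + 2) (block_exponent_ge1 n) V).

(* Main.v *)
Require Import Defs.
From Stdlib Require Import Reals.
From Stdlib Require Import Lra Lia.
From Stdlib Require Import FunctionalExtensionality.
From Coquelicot Require Import Coquelicot.

(** The operator [firsts] that sends a sequence of plane vectors to the sequence
    of their first coordinates has norm 1 and kills every second coordinate.
    In the plane with the p-norm, the unit vector x = (r, r), r = (1/2)^(1/p),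
    satisfies |firsts x| >= r, and r tends to 1 as p grows.  So for every eta
    some block contains an x at which [firsts] almost attains its norm.

    No operator S of norm 1 within 1/4 of [firsts] can attain its norm at such an
    x.  Let z = (0, r).  Since [firsts] vanishes at z, |S z| <= 1/4.  Moving from
    x in the direction x - 2z, that is to w = (1 + t) x - 2t z = (r (1 + t), r (1 - t)),
    the triangle inequality gives

      |w| >= |S w| >= (1 + t) |S x| - 2t |S z| >= 1 + t/2        ([norm_chord_ge]),

    a first-order growth.  But x is a smooth point of the p-plane, and x - 2z is
    tangent to the sphere at x: |w|^p = ((1 + t)^p + (1 - t)^p) / 2 = 1 + O(t^2)
    for fixed p.  The two disagree for small t > 0 ([exists_pow_mean_lt]).

    The real and complex cases are treated at once: besides the module structure,
    the argument only multiplies vectors by real numbers, which any scalar ring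
    with an isometric copy of the reals allows. *)

(** * Powers and roots of real numbers *)

(** Second-order Taylor bound; taking c at least p keeps steps of size
    p / (4 c) inside the unit interval. *)
Lemma pow_1_plus_le (p : nat) : exists c, 0 < c /\ INR p <= c /\
  forall t, -1 <= t <= 1 -> (1 + t) ^ p <= 1 + INR p * t + c * t ^ 2.
Proof.
induction p as [|p [c [Hc [Hpc IH]]]].
- exists 1. simpl. repeat split; try lra. intros t Ht. nra.
- exists (1 + INR p + 2 * c). rewrite S_INR. pose proof (pos_INR p).
  repeat split; try lra. intros t Ht. specialize (IH t Ht).
  apply Rle_trans with ((1 + t) * (1 + INR p * t + c * t ^ 2)).
  + change ((1 + t) ^ S p) with ((1 + t) * (1 + t) ^ p).
    apply Rmult_le_compat_l; lra.
  + pose proof (pow2_ge_0 t).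
    assert (0 <= c * (1 - t) * t ^ 2) by (apply Rmult_le_pos; [apply Rmult_le_pos|]; lra).
    nra.
Qed.

(** The linear terms cancel in the mean on the left, which is 1 + O(t^2), while
    by Bernoulli the right side is at least 1 + p t / 2. *)
Lemma exists_pow_mean_lt (p : nat) : (1 <= p)%nat -> exists t, 0 < t <= 1 /\
  ((1 + t) ^ p + (1 - t) ^ p) / 2 < (1 + t / 2) ^ p.
Proof.
intros Hp. destruct (pow_1_plus_le p) as [c [Hc [Hpc H]]].
assert (Hp' : 1 <= INR p) by (apply (le_INR 1 p Hp)).
(* The gain is p t / 2, the quadratic loss c t^2: this t makes the
   loss half of the gain. *)
set (t := INR p / (4 * c)).
assert (Et : c * t = INR p / 4) by (unfold t; field; lra).
assert (Ht : 0 < t <= 1).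
{ unfold t. split; [apply Rdiv_lt_0_compat; lra|].
  apply Rmult_le_reg_r with (4 * c); [lra|].
  unfold Rdiv. rewrite Rmult_assoc, Rinv_l; lra. }
exists t. split; [exact Ht|].
pose proof (H t ltac:(lra)) as H1. pose proof (H (- t) ltac:(lra)) as H2.
replace (1 + - t) with (1 - t) in H2 by ring.
assert (HB : 1 + INR p * (t / 2) <= (1 + t / 2) ^ p) by (apply poly; lra).
assert (c * t ^ 2 = INR p / 4 * t) by (rewrite <- Et; ring).
assert (0 < INR p * t) by (apply Rmult_lt_0_compat; lra).
nra.
Qed.

Lemma exists_root_half (y : R) : y < 1 -> exists n : nat, y < nth_root (n + 2) (1 / 2).
Proof.
intros Hy.
(* [Rmax] lets a negative y be treated as 0, for which powers are monotone. *)
assert (Hm : Rabs (Rmax 0 y) < 1).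
{ rewrite Rabs_pos_eq by apply Rmax_l. apply Rmax_lub_lt; lra. }
destruct (pow_lt_1_zero _ Hm (1 / 2)) as [n Hn]; [lra|].
exists n. apply Rnot_le_lt. intros Hle.
specialize (Hn (n + 2)%nat ltac:(lia)).
rewrite Rabs_pos_eq in Hn by apply pow_le, Rmax_l.
assert (nth_root (n + 2) (1 / 2) ^ (n + 2) <= Rmax 0 y ^ (n + 2)).
{ apply pow_incr. split; [apply nth_root_ge0|].
  eapply Rle_trans; [exact Hle | apply Rmax_r]. }
rewrite nth_root_pow in H by (lia || lra). lra.
Qed.

(** * Series with one nonzero term and operator norms *)

Lemma is_series_single (i : nat) (c : R) :
  is_series (fun n => if Nat.eq_dec n i then c else 0) c.
Proof.
assert (H : forall m, sum_n (fun n => if Nat.eq_dec n i then c else 0) m =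
                      if Compare_dec.le_dec i m then c else 0).
{ induction m as [|m IH].
  - rewrite sum_O. destruct (Nat.eq_dec 0 i), (Compare_dec.le_dec i 0); reflexivity || lia.
  - rewrite sum_Sn, IH. change plus with Rplus.
    destruct (Nat.eq_dec (S m) i), (Compare_dec.le_dec i m), (Compare_dec.le_dec i (S m));
    (lia || apply Rplus_0_r || apply Rplus_0_l). }
apply (is_lim_seq_ext_loc (fun _ => c)
  (sum_n (fun n => if Nat.eq_dec n i then c else 0)) c).
- exists i. intros m Hm. rewrite H. destruct (Compare_dec.le_dec i m); [reflexivity | contradiction].
- apply is_lim_seq_const.
Qed.

(** Some bound M has to be given: the supremum is taken in the extended reals
    and then cut to a real number, so it says nothing when it is infinite. *)
Lemma op_norm_ub {K : AbsRing} {X Y : NormedModule K} (L : X -> Y) (M : R) :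
  (forall x, norm x <= 1 -> norm (L x) <= M) ->
  forall x, norm x <= 1 -> norm (L x) <= op_norm L.
Proof.
intros HM x Hx. unfold op_norm.
set (A := fun r => exists x, norm x <= 1 /\ r = norm (L x)).
destruct (Lub_Rbar_correct A) as [Hub Hlub].
assert (HA : A (norm (L x))) by now exists x.
destruct (Lub_Rbar A) as [l| |].
- exact (Hub _ HA).
- exfalso. apply (Hlub (Finite M)). intros r [y [Hy ->]]. now apply HM.
- exfalso. exact (Hub _ HA).
Qed.

Lemma op_norm_eq {K : AbsRing} {X Y : NormedModule K} (L : X -> Y) (M : R) :
  (forall x, norm x <= 1 -> norm (L x) <= M) ->
  (exists x, norm x <= 1 /\ norm (L x) = M) -> op_norm L = M.
Proof.
intros HM [x [Hx Hxe]].
assert (E : Lub_Rbar (fun r => exists x, norm x <= 1 /\ r = norm (L x)) = M).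
{ apply is_lub_Rbar_unique. split.
  - intros r [y [Hy ->]]. now apply HM.
  - intros b Hb. apply Hb. now exists x. }
unfold op_norm. now rewrite E.
Qed.

Lemma is_linear_bounded {K : AbsRing} {X Y : NormedModule K} (L : X -> Y) :
  is_linear L -> exists M, forall x, norm x <= 1 -> norm (L x) <= M.
Proof.
intros HL. destruct (linear_norm _ HL) as [M [HM H]].
exists M. intros x Hx. eapply Rle_trans; [apply H|].
rewrite <- (Rmult_1_r M) at 2. apply Rmult_le_compat_l; lra.
Qed.

(** * Multiplication by real scalars *)

(** Says that j is an isometric embedding of the reals as a ring: the identity
    for real scalars, the usual inclusion for complex ones. *)
Record isometric_scalars (K : AbsRing) (j : R -> K) : Prop := {
  js_plus : forall r s, j (r + s) = plus (j r) (j s);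
  js_mult : forall r s, j (r * s) = mult (j r) (j s);
  js_one : j 1 = one;
  js_abs : forall r, abs (j r) = Rabs r }.

Section RealScalars.

Context {K : AbsRing} (j : R -> K) (Hj : isometric_scalars K j).

(** The axioms of a normed module only give an inequality; the inverse scalar
    gives the other one. *)
Lemma norm_scal_real {V : NormedModule K} (r : R) (v : V) :
  norm (scal (j r) v) = Rabs r * norm v.
Proof.
pose proof (norm_scal (j r) v) as H1. rewrite (js_abs _ _ Hj) in H1.
destruct (Req_dec r 0) as [->|Hr].
- rewrite Rabs_R0, Rmult_0_l in *. pose proof (norm_ge_0 (scal (j 0) v)). lra.
- apply Rle_antisym; [exact H1|].
  pose proof (norm_scal (j (/ r)) (scal (j r) v)) as H2.
  rewrite (js_abs _ _ Hj), scal_assoc, <- (js_mult _ _ Hj), Rinv_l, (js_one _ _ Hj) in H2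
    by assumption.
  rewrite (scal_one v) in H2.
  pose proof (Rabs_pos_lt r Hr) as Hr'.
  apply Rmult_le_reg_l with (Rabs (/ r)); [apply Rabs_pos_lt, Rinv_neq_0_compat, Hr|].
  rewrite <- Rmult_assoc, <- Rabs_mult, Rinv_l, Rabs_R1, Rmult_1_l by assumption.
  exact H2.
Qed.

Lemma norm_le_op_norm {X Y : NormedModule K} (L : X -> Y) (x : X) :
  is_linear L -> 0 < norm x -> norm (L x) <= op_norm L * norm x.
Proof.
intros HL Hx. destruct (is_linear_bounded L HL) as [M HM].
assert (Hn : Rabs (/ norm x) = / norm x).
{ apply Rabs_pos_eq. left. now apply Rinv_0_lt_compat. }
pose proof (op_norm_ub L M HM (scal (j (/ norm x)) x)) as H.
rewrite (linear_scal _ HL), !norm_scal_real, Hn, Rinv_l in H by lra.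
specialize (H (Rle_refl 1)).
apply Rmult_le_reg_l with (/ norm x); [now apply Rinv_0_lt_compat|].
replace (/ norm x * (op_norm L * norm x)) with (op_norm L) by (field; lra).
exact H.
Qed.

(** If S attains its norm at x and is small at z, then the norm of the domain
    must grow linearly from x in the direction x - 2z: S itself sees the growth. *)
Lemma norm_chord_ge {X Y : NormedModule K} (S : X -> Y) (x z : X) (t : R) :
  is_linear S -> op_norm S = 1 -> norm (S x) = 1 -> norm (S z) <= 1 / 4 -> 0 <= t ->
  0 < norm (plus (scal (j (1 + t)) x) (scal (j (- (2 * t))) z)) ->
  1 + t / 2 <= norm (plus (scal (j (1 + t)) x) (scal (j (- (2 * t))) z)).
Proof.
intros HS HS1 Hx Hz Ht Hw. set (w := plus _ _) in *.
pose proof (norm_le_op_norm S w HS Hw) as H. rewrite HS1, Rmult_1_l in H.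
eapply Rle_trans; [|exact H].
unfold w. rewrite (linear_plus _ HS), !(linear_scal _ HS).
set (a := scal _ (S x)). set (b := scal _ (S z)).
assert (Ha : norm a = 1 + t).
{ unfold a. rewrite norm_scal_real, Hx, Rabs_pos_eq; lra. }
assert (Hb : norm b <= t / 2).
{ unfold b. rewrite norm_scal_real, Rabs_Ropp, Rabs_pos_eq by lra. nra. }
change (1 + t / 2 <= norm (plus a b)).
assert (H3 : norm a <= norm (plus a b) + norm b); [|lra].
replace a with (plus (plus a b) (opp b)) at 1.
- eapply Rle_trans; [apply norm_triangle|].
  apply Rplus_le_compat_l, Req_le, norm_opp.
- rewrite <- plus_assoc. rewrite <- (plus_zero_r a) at 2.
  apply f_equal. exact (plus_opp_r b).
Qed.

End RealScalars.

(** * The operator of first coordinates on the sum of planes *)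

Section Planes.

Context {K : AbsRing} (V : CompleteNormedModule K).

Let X := l2_sum_of_planes V.
Let Y := linf V.

Lemma norm_zero_coord : norm (zero : V) = 0.
Proof. exact (norm_zero (V := V)). Qed.

(** All the planes have the same vectors and differ only in their norms, so a
    sequence of vectors of the planes is an ordinary function into [V * V]. *)
Definition single_seq (i : nat) (w : V * V) : nat -> V * V :=
  fun n => if Nat.eq_dec n i then w else (zero, zero).

(** Convertible to the norm of the plane of index i, with an argument type that
    does not depend on i. *)
Definition plane_norm (i : nat) (w : V * V) : R :=
  nth_root (i + 2) (norm (fst w) ^ (i + 2) + norm (snd w) ^ (i + 2)).

Lemma is_series_single_seq (i : nat) (w : V * V) :
  is_series (fun n => plane_norm n (single_seq i w n) ^ 2) (plane_norm i w ^ 2).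
Proof.
apply (is_series_ext (fun n => if Nat.eq_dec n i then plane_norm i w ^ 2 else 0)).
- intros n. unfold single_seq. destruct (Nat.eq_dec n i) as [->|Hn]; [reflexivity|].
  unfold plane_norm. simpl fst. simpl snd.
  rewrite norm_zero_coord, pow_i, Rplus_0_r by lia.
  unfold nth_root. destruct (Rle_dec 0 0); [|lra]. change (0 = 0 ^ 2 :> R). ring.
- apply is_series_single.
Qed.

Definition single (i : nat) (w : V * V) : X :=
  exist _ (single_seq i w) (ex_intro _ _ (is_series_single_seq i w)).

Lemma norm_single i w : norm (single i w) = plane_norm i w.
Proof.
change (norm (single i w))
  with (sqrt (Series (fun n => plane_norm n (single_seq i w n) ^ 2))).
rewrite (is_series_unique _ _ (is_series_single_seq i w)).
apply sqrt_pow2, nth_root_ge0.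
Qed.

Lemma single_plus i (v w : prod_ModuleSpace K V V) :
  plus (single i v) (single i w) = single i (plus v w).
Proof.
apply sm_eq. apply functional_extensionality_dep. intros n.
change (plus (single_seq i v n : prod_ModuleSpace K V V) (single_seq i w n)
  = single_seq i (plus v w) n).
unfold single_seq. destruct (Nat.eq_dec n i); [reflexivity|].
apply (plus_zero_r (zero : prod_ModuleSpace K V V)).
Qed.

Lemma single_scal i k (w : prod_ModuleSpace K V V) :
  scal k (single i w) = single i (scal k w).
Proof.
apply sm_eq. apply functional_extensionality_dep. intros n.
change (scal k (single_seq i w n : prod_ModuleSpace K V V)
  = single_seq i (scal k w) n).
unfold single_seq. destruct (Nat.eq_dec n i); [reflexivity|].
apply (scal_zero_r (V := prod_ModuleSpace K V V) k).
Qed.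

Definition coord (x : X) (n : nat) : V * V := proj1_sig x n.

Lemma norm_fst_coord_le (x : X) n : norm (fst (coord x n)) <= norm x.
Proof.
apply Rle_trans with (plane_norm n (coord x n)).
{ apply (lp_plane_fst (n + 2) (block_exponent_ge1 n) V). }
set (a := fun n => plane_norm n (coord x n)).
change (a n <= sqrt (Series (fun n => a n ^ 2))).
eapply Rle_trans; [apply (ss_ge _ l2_seminorms n a)|].
- intros m. apply nth_root_ge0.
- apply sqrt_le_1_alt, sum_sq_le_Series. exact (proj2_sig x).
Qed.

Lemma linf_norm_ge (y : Y) n : norm (proj1_sig y n : V) <= norm y.
Proof.
change (norm y) with (linf_norm V y). unfold linf_norm.
destruct y as [y [M HM]]. simpl.
set (A := fun r => exists n, r = norm (y n)).
destruct (Lub_Rbar_correct A) as [Hub Hlub].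
assert (HA : A (norm (y n))) by now exists n.
destruct (Lub_Rbar A) as [l| |].
- exact (Hub _ HA).
- exfalso. apply (Hlub (Finite M)). intros r [m ->]. apply HM.
- exfalso. exact (Hub _ HA).
Qed.

Lemma linf_norm_le (y : Y) M : (forall n, norm (proj1_sig y n : V) <= M) -> norm y <= M.
Proof.
intros HM. change (norm y) with (linf_norm V y). unfold linf_norm.
set (A := fun r => _).
destruct (Lub_Rbar_correct A) as [Hub Hlub].
assert (H : Rbar_le (Lub_Rbar A) M) by (apply Hlub; intros r [n ->]; apply HM).
assert (HA : A (norm (proj1_sig y 0%nat : V))) by now exists 0%nat.
pose proof (Hub _ HA).
destruct (Lub_Rbar A); try contradiction. exact H.
Qed.

Definition firsts (x : X) : Y :=
  exist _ (fun n => fst (coord x n)) (ex_intro _ (norm x) (norm_fst_coord_le x)).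

Lemma norm_firsts_le x : norm (firsts x) <= norm x.
Proof. apply linf_norm_le. intros n. exact (norm_fst_coord_le x n). Qed.

Lemma is_linear_firsts : is_linear firsts.
Proof.
split.
- intros x y. apply sm_eq. reflexivity.
- intros k x. apply sm_eq. reflexivity.
- exists 1. split; [lra|]. intros x. rewrite Rmult_1_l. apply norm_firsts_le.
Qed.

Lemma norm_firsts_single_ge i (w : V * V) : norm (fst w) <= norm (firsts (single i w)).
Proof.
eapply Rle_trans; [|apply (linf_norm_ge _ i)].
apply Req_le. simpl. unfold coord, single, single_seq; simpl.
destruct (Nat.eq_dec i i); [reflexivity|contradiction].
Qed.

Lemma firsts_single_snd i (v : V) : firsts (single i (zero, v)) = zero.
Proof.
apply sm_eq. apply functional_extensionality_dep. intros n.
change (fst (single_seq i (zero, v) n) = zero).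
unfold single_seq. now destruct (Nat.eq_dec n i).
Qed.

Lemma plane_norm_fst i (v : V) : plane_norm i (v, zero) = norm v.
Proof.
apply Rle_antisym.
- pose proof (lp_plane_le (i + 2) (block_exponent_ge1 i) V (v, zero)) as H.
  change (plane_norm i (v, zero) <= norm v + norm (zero : V)) in H.
  rewrite norm_zero_coord, Rplus_0_r in H. exact H.
- exact (lp_plane_fst (i + 2) (block_exponent_ge1 i) V (v, zero)).
Qed.

(** * Failure of the property *)

(** V plays the role of the scalar field, a module over itself, and e that of
    its unit. *)
Theorem not_property_Lpo (j : R -> K) (e : V) :
  isometric_scalars K j -> norm e = 1 -> ~ property_Lpo X Y.
Proof.
intros Hj He HL.
assert (HT1 : op_norm firsts = 1).
{ apply op_norm_eq.
  - intros x Hx. eapply Rle_trans; [apply norm_firsts_le | exact Hx].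
  - exists (single 0 (e, zero)).
    assert (Hn : norm (single 0 (e, zero)) = 1).
    { rewrite norm_single, plane_norm_fst. exact He. }
    split; [now apply Req_le|]. apply Rle_antisym.
    + rewrite <- Hn. apply norm_firsts_le.
    + rewrite <- He. apply (norm_firsts_single_ge 0 (e, zero)). }
destruct (HL (1 / 4) ltac:(lra) firsts is_linear_firsts HT1) as [eta [Heta H]].
destruct (exists_root_half (1 - eta) ltac:(lra)) as [i Hi].
set (p := (i + 2)%nat) in *. set (r := nth_root p (1 / 2)) in *.
assert (Hp : (1 <= p)%nat) by (unfold p; lia).
assert (Hr0 : 0 <= r) by apply nth_root_ge0.
assert (Hrp : r ^ p = 1 / 2) by (apply nth_root_pow; [exact Hp | lra]).
assert (Hre : forall s, norm (scal (j s) e) = Rabs s).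
{ intros s. rewrite <- (Rmult_1_r (Rabs s)), <- He. exact (norm_scal_real j Hj s e). }
set (x := single i (scal (j r) e, scal (j r) e)).
set (z := single i (zero, scal (j r) e)).
assert (Hpl : forall a b, 0 <= a -> 0 <= b ->
  norm (single i (scal (j a) e, scal (j b) e)) ^ p = a ^ p + b ^ p).
{ intros a b Ha Hb. rewrite norm_single. unfold plane_norm. fold p. simpl fst; simpl snd.
  rewrite !Hre, !Rabs_pos_eq by assumption.
  apply nth_root_pow; [exact Hp|]. apply Rplus_le_le_0_compat; now apply pow_le. }
assert (Hx : norm x = 1).
{ assert (Ex : norm x ^ p = 1 ^ p) by (unfold x; rewrite Hpl, pow1 by assumption; lra).
  apply Rle_antisym; apply (pow_le_inv p); try apply norm_ge_0; try lra; exact Hp. }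
assert (Hz : norm z <= 1).
{ unfold z. rewrite norm_single.
  pose proof (lp_plane_le (i + 2) (block_exponent_ge1 i) V (zero, scal (j r) e)) as Hl.
  change (plane_norm i (zero, scal (j r) e) <= norm (zero : V) + norm (scal (j r) e)) in Hl.
  rewrite norm_zero_coord, Hre, Rplus_0_l, Rabs_pos_eq in Hl
    by assumption.
  eapply Rle_trans; [exact Hl|]. apply (pow_le_inv p); try lra; [exact Hp|].
  rewrite Hrp, pow1. lra. }
destruct (H x Hx) as [S [HS [HS1 [HSx HST]]]].
{ eapply Rlt_le_trans; [exact Hi|].
  eapply Rle_trans; [|apply (norm_firsts_single_ge i)]. simpl fst.
  rewrite Hre. apply Rle_abs. }
assert (HSz : norm (S z) <= 1 / 4).
{ left. eapply Rle_lt_trans; [|exact HST].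
  destruct (is_linear_bounded S HS) as [M HM].
  replace (S z) with (minus (S z) (firsts z)).
  - apply (op_norm_ub (fun z => minus (S z) (firsts z)) (M + 1)); [|exact Hz].
    intros y Hy. eapply Rle_trans; [exact (norm_triangle (S y) (opp (firsts y)))|].
    apply Rplus_le_compat; [now apply HM|].
    eapply Rle_trans; [exact (Req_le _ _ (norm_opp (firsts y)))|].
    eapply Rle_trans; [apply norm_firsts_le | exact Hy].
  - unfold z. rewrite firsts_single_snd. exact (minus_zero_r (S _)). }
destruct (exists_pow_mean_lt p Hp) as [t [Ht Hlt]].
set (w := plus (scal (j (1 + t)) x) (scal (j (- (2 * t))) z)).
assert (Ew : w = single i (scal (j (r * (1 + t))) e, scal (j (r * (1 - t))) e)).
{ unfold w, x, z. rewrite !single_scal, single_plus. apply f_equal.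
  apply (f_equal2 (@pair V V)).
  - change (plus (scal (j (1 + t)) (scal (j r) e)) (scal (j (- (2 * t))) (zero : V))
      = scal (j (r * (1 + t))) e).
    rewrite (scal_zero_r (V := V)), plus_zero_r, scal_assoc, <- (js_mult _ _ Hj).
    apply (f_equal (fun s => scal (j s) e)). ring.
  - change (plus (scal (j (1 + t)) (scal (j r) e)) (scal (j (- (2 * t))) (scal (j r) e))
      = scal (j (r * (1 - t))) e).
    rewrite <- (scal_distr_r (V := V)), <- (js_plus _ _ Hj), scal_assoc, <- (js_mult _ _ Hj).
    apply (f_equal (fun s => scal (j s) e)). ring. }
assert (Hwp : norm w ^ p = ((1 + t) ^ p + (1 - t) ^ p) / 2).
{ rewrite Ew, Hpl by (apply Rmult_le_pos; lra). rewrite !Rpow_mult_distr, Hrp. field. }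
assert (Hw : 0 < norm w).
{ destruct (norm_ge_0 w) as [|E0]; [assumption|exfalso].
  rewrite <- E0, pow_i in Hwp by lia.
  pose proof (pow_lt (1 + t) p ltac:(lra)). pose proof (pow_le (1 - t) p ltac:(lra)). lra. }
assert (Hge : 1 + t / 2 <= norm w).
{ exact (norm_chord_ge j Hj S x z t HS HS1 HSx HSz ltac:(lra) Hw). }
pose proof (pow_incr (1 + t / 2) (norm w) p ltac:(lra)). lra.
Qed.

End Planes.

Theorem proposition2p9 :
  ~ property_Lpo (l2_sum_of_planes R_CompleteNormedModule) (linf R_CompleteNormedModule) /\
  ~ property_Lpo (l2_sum_of_planes C_CompleteNormedModule) (linf C_CompleteNormedModule).
Proof.
split.
- apply (not_property_Lpo R_CompleteNormedModule (fun r => r) 1); [split; reflexivity|].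
  apply Rabs_R1.
- apply (not_property_Lpo C_CompleteNormedModule RtoC (RtoC 1)); [split|].
  + exact RtoC_plus.
  + exact RtoC_mult.
  + reflexivity.
  + exact Cmod_R.
  + exact Cmod_1.
Qed.
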